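(* Every Doyle spiral is conformally symmetric, i.e. for each of its flowers all six s-circles intersect in one point.
   Context: Let $\omega=e^{i\pi/3}$ and $HL=\{n+m\omega:n,m\in\mathbb Z\}$. Circles are nondegenerate circles in the Riemann sphere $\hat{\mathbb C}$, lines included. Two oriented circles touch with opposite orientations if they are tangent and their orientations at the tangency point are opposite (equivalently, the open discs to their left are disjoint). A (hexagonal) flower consists of an oriented circle $C$ (the center) and six oriented circles $\mathcal P_1,\dots,\mathcal P_6$ (the petals, indices mod $6$) such that: each $\mathcal P_k$ touches $C$ at a point $z_k$ with opposite orientations; $z_1,\dots,z_6$ are distinct and cyclically ordered on $C$ in the positive direction; and $\mathcal P_k$, $\mathcal P_{k+1}$ touch with opposite orientations, at a point $w_k$, for all $k$ mod $6$. Non-neighboring petals may intersect. For each $k$ the points $z_{k-1},z_{k+1},w_k,w_{k-1}$ lie on a unique circle $S_k$; $S_1,\dots,S_6$ are the s-circles of the flower. An entire (immersed) hexagonal circle packing is a family of oriented circles $(C_v)_{v\in HL}$ such that for every $v\in HL$ the circle $C_v$ with petals $\mathcal P_k=C_{v+\omega^k}$, $k=1,\dots,6$, is a flower. It is conformally symmetric if for each of its flowers the six s-circles intersect in one point. A Doyle spiral is an entire hexagonal circle packing by Euclidean circles in $\mathbb C$ (positively oriented, i.e. the discs are the bounded ones) such that for every flower, with $R$ the radius of the center and $R_1,\dots,R_6$ the radii of the petals in cyclic order, $$R_kR_{k+3}=R^2,\qquad R_kR_{k+2}R_{k+4}=R^3\qquad(k\ \mathrm{mod}\ 6).$$ *)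

(* Defs.v *)
From mathcomp Require Import all_boot all_order all_algebra.
From mathcomp Require Import complex.
From mathcomp Require Import classical_sets reals interval_inference trigo.

Set Implicit Arguments.
Unset Strict Implicit.
Unset Printing Implicit Defensive.

Import Order.TTheory GRing.Theory Num.Theory.

Local Open Scope ring_scope.
Local Open Scope complex_scope.
Local Open Scope classical_set_scope.

(* The Riemann sphere; [None] is the point at infinity. *)
Definition sphere (R : realType) : Type := option R[i].

Section OrientedCircles.
Variable R : realType.
Implicit Types (c p u x y z : R[i]) (A B : set (sphere R)).

(* [OCircle c r ccw] is the circle |x - c| = r, positively oriented (disc of
   radius r on the left) when [ccw] is true and negatively otherwise.
   [OLine p u _] is the line through p, together with infinity, traversed in
   the direction u; its parameters are not unique, so oriented circles are only
   ever compared through the point sets below. *)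
Variant ocircle : Type :=
  | OCircle of R[i] & {posnum R} & bool
  | OLine (p u : R[i]) of u != 0.

Definition points (C : ocircle) : set (sphere R) :=
  match C with
  | OCircle c r _ =>
      [set s | if s is Some x then `|x - c| = (r%:num)%:C else False]
  | OLine p u _ =>
      [set s | if s is Some x then complex.Im (u^* * (x - p)) = 0 else True]
  end.

Definition left_disc (C : ocircle) : set (sphere R) :=
  match C with
  | OCircle c r true =>
      [set s | if s is Some x then `|x - c| < (r%:num)%:C else False]
  | OCircle c r false =>
      [set s | if s is Some x then (r%:num)%:C < `|x - c| else True]
  | OLine p u _ =>
      [set s | if s is Some x then 0 < complex.Im (u^* * (x - p)) else False]
  end.

(* Twice the signed area of the triangle x, y, z; positive exactly when the
   triangle is counterclockwise. *)
Definition signed_area x y z : R := complex.Im ((y - x)^* * (z - x)).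

(* [s] comes before [t] on a line of direction u, infinity being last. *)
Definition line_lt u (s t : sphere R) : Prop :=
  match s, t with
  | Some x, Some y => 0 < complex.Re (u^* * (y - x))
  | Some _, None => True
  | None, _ => False
  end.

(* For s1, s2, s3 on C: they are distinct and met in this cyclic order when C
   is traversed in its positive direction. *)
Definition positively_ordered (C : ocircle) (s1 s2 s3 : sphere R) : Prop :=
  match C with
  | OCircle _ _ ccw =>
      match s1, s2, s3 with
      | Some x, Some y, Some z =>
          if ccw then 0 < signed_area x y z else signed_area x y z < 0
      | _, _, _ => False
      end
  | OLine _ u _ =>
      [\/ line_lt u s1 s2 /\ line_lt u s2 s3,
          line_lt u s2 s3 /\ line_lt u s3 s1 |
          line_lt u s3 s1 /\ line_lt u s1 s2]
  end.

Definition is_circle A : Prop := exists C : ocircle, A = points C.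

(* Distinct circles of the sphere are tangent when they share exactly one point;
   the orientations there are opposite when the left discs are disjoint. *)
Definition touch_opposite (C D : ocircle) (s : sphere R) : Prop :=
  points C `&` points D = [set s] /\ left_disc C `&` left_disc D = set0.

(* Indices modulo 6 are elements of 'Z_6, so that P_6 is indexed by 0. *)
Definition flower (C : ocircle) (P : 'Z_6 -> ocircle) (z w : 'Z_6 -> sphere R)
    : Prop :=
  [/\ forall k, touch_opposite (P k) C (z k),
      injective z,
      forall i j k : 'Z_6, (i < j)%N -> (j < k)%N ->
        positively_ordered C (z i) (z j) (z k) &
      forall k, touch_opposite (P k) (P (k + 1)) (w k)].

Definition s_circle (z w : 'Z_6 -> sphere R) (k : 'Z_6) : set (sphere R) -> Prop :=
  unique (fun S => is_circle S /\
    [/\ S (z (k - 1)), S (z (k + 1)), S (w k) & S (w (k - 1))]).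

Definition s_circles_concurrent (z w : 'Z_6 -> sphere R) : Prop :=
  exists S : 'Z_6 -> set (sphere R),
    (forall k, s_circle z w k (S k)) /\ exists! s, forall k, S k s.

End OrientedCircles.

Section Packings.
Variable R : realType.

Definition omega : R[i] := cos (pi / 3) +i* sin (pi / 3).

Definition HL : set R[i] :=
  [set v | exists n m : int, v = n%:~R + m%:~R * omega].

Definition petals (C : R[i] -> ocircle R) (v : R[i]) (k : 'Z_6) : ocircle R :=
  C (v + omega ^+ k).

(* A family indexed by HL is a function on R[i] whose values outside HL are
   never used. *)
Definition entire_packing (C : R[i] -> ocircle R) : Prop :=
  forall v, HL v -> exists z w, flower (C v) (petals C v) z w.

(* The points z, w of a flower are determined by its circles. *)
Definition conformally_symmetric (C : R[i] -> ocircle R) : Prop :=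
  entire_packing C /\
  forall v, HL v -> forall z w, flower (C v) (petals C v) z w ->
    s_circles_concurrent z w.

Definition Doyle_spiral (C : R[i] -> ocircle R) : Prop :=
  entire_packing C /\
  exists (c : R[i] -> R[i]) (r : R[i] -> {posnum R}),
    (forall v, HL v -> C v = OCircle (c v) (r v) true) /\
    forall v, HL v -> forall k : 'Z_6,
      let rho := (r v)%:num in
      let rho_ (j : 'Z_6) := (r (v + omega ^+ j))%:num in
      rho_ k * rho_ (k + 3) = rho ^+ 2 /\
      rho_ k * rho_ (k + 2) * rho_ (k + 4) = rho ^+ 3.

End Packings.

(* Main.v *)
Require Import Defs.
From mathcomp Require Import all_boot all_order all_algebra.
From mathcomp Require Import complex reals.
From mathcomp Require Import classical_sets interval_inference trigo ring lra.

(** Normalise a flower so that its center is the unit circle, with contact points [u k], and let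
    [r k] be the radii of the petals. The angle at 0 from [u k] to [u (k + 1)] has half-angle
    tangent [t k], where [t k ^ 2 (1 + r k + r (k + 1)) = r k r (k + 1)]; the Doyle relations
    amount to [r k r (k + 2) = r (k + 1)] and imply [t (k + 2) = t k / r k], so that
    [g = t k t (k + 3)] does not depend on [k].

    In a Doyle spiral with center of similitude 0, the contact points of a flower are proportional
    to square roots of the centers of its petals. Write [X k] for these square roots, [X k ^ 2]
    being the multiplier of the spiral similarity from the center circle to the petal. Then
    [|X k|^2 = r k], and the circle of radius [|X k|] about [e k] passes through [u (k - 1)],
    [u (k + 1)], [w k = e k + X k u (k + 1)], [w (k - 1) = e k + X k u (k - 1)] and
    [p = e k - u k (X k)^*]. The point [p] does not depend on [k].
    In terms of [t], both [X] and [e] are rational and make sense also for the regular flower,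
    whose center of similitude is at infinity.

    The s-circles [S k] and [S (k + 2)] share [p] and [u (k + 1)]. If they shared a third point
    they would coincide and contain [u (k - 1)], [u (k + 1)], [u (k + 3)], so be equal to the center
    circle, which does not contain [w k]. *)

Set Implicit Arguments.
Unset Strict Implicit.
Unset Printing Implicit Defensive.

Import Order.TTheory GRing.Theory Num.Theory.

Local Open Scope ring_scope.
Local Open Scope complex_scope.

(** * Algebra of a flower around one petal *)

(* Seen from the petal of radius [x y], whose neighbours have radii [x] and [y], the half-angle
   tangents of the two adjacent angles are [a x] and [b y]. The element [i] is an arbitrary square
   root of -1, so that replacing it by [-i] while exchanging [a] with [b] and [x] with [y] gives the
   mirror image of each statement. *)
Section Frame.
Variables (F : fieldType) (i a b s x y : F).
Hypotheses (i2 : i ^+ 2 = -1) (xE : x = s * b ^+ 2 * (1 + a ^+ 2))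
  (yE : y = s * a ^+ 2 * (1 + b ^+ 2)) (xyE : 1 + x * y = s * (1 - (a * b) ^+ 2)).

(* The relation [xyE] solved for its leading monomial: a rewrite rule for [ring]. *)
Lemma scale_rule : s ^+ 2 * a ^+ 4 * b ^+ 4 = s * (1 - (a * b) ^+ 2) - 1
   - s ^+ 2 * (a ^+ 2 * b ^+ 2 + a ^+ 4 * b ^+ 2 + a ^+ 2 * b ^+ 4).
Proof. by rewrite -xyE xE yE; ring. Qed.

(** Here [u] and [u'] are the contacts of the petal and of its neighbour of radius [y] with the unit
    circle, and [w] is the contact of these two petals. With denominators cleared, all points become
    multiples of [u], leaving a polynomial identity modulo [i2] and [scale_rule]. *)
Lemma contact_from_center u u' w e : 1 + x != 0 -> 1 + a * b != 0 -> 1 - i * (b * y) != 0 ->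
  u' * (1 - i * (b * y)) = u * (1 + i * (b * y)) ->
  w * (1 + x) = (1 + x * y) * u + x * (1 + y) * u' ->
  e * (1 + a * b) = u * (1 - i * (a * x)) * (1 + i * (b * y)) ->
  w = e + s * a * b * (1 + i * b) * (1 - i * a) * u'.
Proof.
move=> x0 g0 T0 u'E wE eE.
apply/(mulIf x0)/(mulIf g0)/(mulIf T0); rewrite wE.
pose X := s * a * b * (1 + i * b) * (1 - i * a).
transitivity ((1 + a * b) * ((1 + x * y) * u * (1 - i * (b * y))
   + x * (1 + y) * (u' * (1 - i * (b * y))))); first by ring.
transitivity ((1 + x) * (e * (1 + a * b) * (1 - i * (b * y)) +
   X * (1 + a * b) * (u' * (1 - i * (b * y))))); last by rewrite /X; ring.
by rewrite u'E eE /X xE yE; ring: i2 scale_rule.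
Qed.

(* The letters [v], [v'], [f] stand for the conjugates of [u], [u'], [e]. *)
Lemma contact_center_dist u v u' v' e f :
  1 + a * b != 0 -> 1 - i * (b * y) != 0 -> 1 + i * (b * y) != 0 ->
  u * v = 1 ->
  u' * (1 - i * (b * y)) = u * (1 + i * (b * y)) ->
  v' * (1 + i * (b * y)) = v * (1 - i * (b * y)) ->
  e * (1 + a * b) = u * (1 - i * (a * x)) * (1 + i * (b * y)) ->
  f * (1 + a * b) = v * (1 + i * (a * x)) * (1 - i * (b * y)) ->
  (u' - e) * (v' - f) = x * y.
Proof.
move=> g0 T0 T0' uv u'E v'E eE fE.
apply/(mulIf g0)/(mulIf g0)/(mulIf T0)/(mulIf T0').
transitivity ((u' * (1 - i * (b * y)) * (1 + a * b) - e * (1 + a * b) * (1 - i * (b * y))) *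
  (v' * (1 + i * (b * y)) * (1 + a * b) - f * (1 + a * b) * (1 + i * (b * y)))); first by ring.
rewrite u'E v'E eE fE.
transitivity (u * v *
  ((1 + i * (b * y)) * (1 + a * b) - (1 - i * (a * x)) * (1 + i * (b * y)) * (1 - i * (b * y))) *
  ((1 - i * (b * y)) * (1 + a * b) - (1 + i * (a * x)) * (1 - i * (b * y)) * (1 + i * (b * y)))).
  by ring.
by rewrite uv xE yE; ring: i2 scale_rule.
Qed.

(** Eliminates [e]: as [a * b] is the same for all petals, only [u] and the conjugate of [X] remain
    to be compared from one petal to the next. *)
Lemma common_point_form u e :
  e * (1 + a * b) = u * (1 - i * (a * x)) * (1 + i * (b * y)) ->
  (e - u * (s * a * b * (1 - i * b) * (1 + i * a))) * (1 + a * b) =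
    u * (1 - a * b - 2 * (a * b) * (s * a * b * (1 - i * b) * (1 + i * a))).
Proof.
by move=> eE; rewrite mulrBl eE xE yE; ring: i2 scale_rule.
Qed.

(* Around the next petal, [a], [b], [s] become [b / x], [a x], [s']. *)
Lemma common_point_form_next s' :
  x != 0 -> 1 - (a * b) ^+ 2 != 0 -> s' * (1 - (a * b) ^+ 2) = 1 + y ->
  (1 - i * (b * y)) * (1 - a * b - 2 * (a * b) * (s * a * b * (1 - i * b) * (1 + i * a)))
  = (1 + i * (b * y)) *
    (1 - a * b - 2 * (a * b) * (s' * a * b * (1 - i * (a * x)) * (1 + i * (b / x)))).
Proof.
move=> x0 g0 s'E.
apply/(mulIf x0)/(mulIf g0).
(* The factor [1 - (a * b) ^+ 2] turns the scales [s] and [s'] into [1 + x * y] and [1 + y]. *)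
transitivity ((1 - i * (b * y)) * ((1 - a * b) * (1 - (a * b) ^+ 2) -
    2 * (a * b) * ((1 + x * y) * a * b * (1 - i * b) * (1 + i * a))) * x).
  by rewrite xyE; ring.
transitivity ((1 + i * (b * y)) * ((1 - a * b) * (1 - (a * b) ^+ 2) * x -
    2 * (a * b) * ((s' * (1 - (a * b) ^+ 2)) * a * b * (1 - i * (a * x)) * (x + i * b)))); last first.
  by field.
by rewrite s'E xE yE; ring: i2 scale_rule.
Qed.
End Frame.

(** * Tangent circles and circles through three points *)

Definition sqn (R : realType) (z : R[i]) : R := complex.Re z ^+ 2 + complex.Im z ^+ 2.

Lemma sqnE (R : realType) (z : R[i]) : (sqn z)%:C = z * z^*%C.
Proof. by rewrite /sqn add_Re2_Im2 sqr_normc. Qed.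

Lemma normc_sqn (R : realType) (z : R[i]) : `|z| = (Num.sqrt (sqn z))%:C.
Proof. by rewrite normc_def. Qed.

Lemma sqn_ge0 (R : realType) (z : R[i]) : 0 <= sqn z.
Proof. by rewrite addr_ge0 ?sqr_ge0. Qed.

Lemma sqnM (R : realType) (z w : R[i]) : sqn (z * w) = sqn z * sqn w.
Proof. by case: z w => [a b] [c d]; rewrite /sqn /=; ring. Qed.

Lemma sqnC (R : realType) (a : R) : sqn a%:C = a ^+ 2.
Proof. by rewrite /sqn /= expr0n addr0. Qed.

Lemma sqn_eq0 (R : realType) (z : R[i]) : sqn z = 0 -> z = 0.
Proof.
case: z => a b /eqP; rewrite /sqn /= paddr_eq0 ?sqr_ge0 // !sqrf_eq0.
by case/andP => /eqP-> /eqP->.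
Qed.

Lemma on_circle (R : realType) (z : R[i]) (r : R) : 0 <= r ->
  `|z| = r%:C <-> sqn z = r ^+ 2.
Proof.
move=> r0; rewrite normc_sqn; split=> [[<-]|->]; first by rewrite sqr_sqrtr ?sqn_ge0.
by rewrite sqrtr_sqr ger0_norm.
Qed.

Lemma in_disc (R : realType) (z : R[i]) (r : R) : 0 < r ->
  (`|z| < r%:C) = (sqn z < r ^+ 2).
Proof.
move=> r0; rewrite normc_sqn ltcR -[r in LHS]gtr0_norm // -sqrtr_sqr ltr_sqrt //.
by rewrite exprn_gt0.
Qed.

(** Disjoint discs put the centers at least [r + s] apart, and a common point puts them at most that
    far: by [key] the defect is, up to a positive factor, the squared length of a vector. Equality
    makes this vector vanish, which locates the common point. *)
Lemma touch_circles (R : realType) (a b : R[i]) (r s : {posnum R}) (t : sphere R) :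
  touch_opposite (OCircle a r true) (OCircle b s true) t ->
  sqn (b - a) = (r%:num + s%:num) ^+ 2 /\
  t = Some (a + (r%:num / (r%:num + s%:num))%:C * (b - a)).
Proof.
case=> ptE discE.
have: [set t]%classic t by [].
rewrite -ptE; case: t {ptE} => [x|[[]]] //= [].
move: discE; move: r s => r s.
have r0 : 0 < r%:num by [].
have s0 : 0 < s%:num by [].
move: r0 s0; set p := r%:num; set q := s%:num => p0 q0 discE.
rewrite /= !(on_circle _ (ltW _)) // => xa xb.
have rs0 : 0 < p + q by rewrite addr_gt0.
(* Otherwise the point of the segment of centers dividing it as [p : q] is in both discs. *)
have Dge : (p + q) ^+ 2 <= sqn (b - a).
  rewrite leNgt; apply/negP => Dlt.
  suff : (@set0 (sphere R)) (Some (a + (p / (p + q))%:C * (b - a))) by [].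
  rewrite -discE.
  split => /=; rewrite in_disc //.
    rewrite addrAC subrr add0r sqnM sqnC exprMn -[X in _ < X]mulr1 -mulrA ltr_pM2l ?exprn_gt0 //.
    by rewrite exprVn mulrC ltr_pdivrMr ?exprn_gt0 // mul1r.
  have -> : a + (p / (p + q))%:C * (b - a) - b = (- (q / (p + q)))%:C * (b - a).
    have -> : - (q / (p + q)) = p / (p + q) - 1 by field; rewrite gt_eqF.
    by rewrite rmorphB /=; ring.
  rewrite sqnM sqnC sqrrN exprMn -[X in _ < X]mulr1 -mulrA ltr_pM2l ?exprn_gt0 //.
  by rewrite exprVn mulrC ltr_pdivrMr ?exprn_gt0 // mul1r.
have key : sqn ((p + q)%:C * (x - a) - p%:C * (b - a)) =
    p * q * ((p + q) ^+ 2 - sqn (b - a)).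
  move: xa xb; case: (x) (a) (b) => [x1 x2] [a1 a2] [b1 b2]; rewrite /sqn /= => xa xb.
  transitivity ((p + q) * q * ((x1 - a1) ^+ 2 + (x2 - a2) ^+ 2) +
    (p + q) * p * ((x1 - b1) ^+ 2 + (x2 - b2) ^+ 2) - p * q * ((b1 - a1) ^+ 2 + (b2 - a2) ^+ 2)).
    by ring.
  by rewrite xa xb; ring.
have DE : sqn (b - a) = (p + q) ^+ 2.
  apply/le_anti; rewrite Dge andbT -subr_ge0 -(pmulr_rge0 _ (mulr_gt0 p0 q0)) -key.
  exact: sqn_ge0.
split=> //; congr Some.
have /sqn_eq0/subr0_eq xE : sqn ((p + q)%:C * (x - a) - p%:C * (b - a)) = 0.
  by rewrite key DE subrr mulr0.
have pq0 : (p + q)%:C != 0 by rewrite (fmorph_eq0 (real_complex R)) gt_eqF.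
apply: (mulfI pq0); rewrite rmorphM fmorphV /= mulrDr mulrA mulrCA mulfV // mulr1 -xE.
by ring.
Qed.

(** Equidistance from [e] gives [|y - x|^2 = 2 (e - x).(y - x)], and likewise for [z]. With zero
    area this yields [prop], whose squared norms force [|y - x| = |z - x|] and hence [y = z]. *)
Lemma not_collinear (R : realType) (e x y z : R[i]) :
  sqn (y - e) = sqn (x - e) -> sqn (z - e) = sqn (x - e) ->
  x <> y -> x <> z -> y <> z -> signed_area x y z != 0.
Proof.
move=> ye ze xy xz yz; apply/eqP => area0.
have prop : (sqn (y - x))%:C * (z - x) = (sqn (z - x))%:C * (y - x).
  move: ye ze area0 {xy xz yz}; case: x y z e => [x1 x2] [y1 y2] [z1 z2] [e1 e2].
  rewrite /sqn /signed_area /= => ye ze area0; apply/eqP; rewrite eq_complex /=.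
  have yE : (y1 - x1) ^+ 2 + (y2 - x2) ^+ 2 = 2 * ((e1 - x1) * (y1 - x1) + (e2 - x2) * (y2 - x2)).
    lra.
  have zE : (z1 - x1) ^+ 2 + (z2 - x2) ^+ 2 = 2 * ((e1 - x1) * (z1 - x1) + (e2 - x2) * (z2 - x2)).
    lra.
  rewrite yE zE.
  apply/andP; split; apply/eqP.
    transitivity (2 * ((e1 - x1) * (z1 - x1) + (e2 - x2) * (z2 - x2)) * (y1 - x1) -
      2 * (e2 - x2) * ((y1 - x1) * (z2 - x2) + - (y2 - x2) * (z1 - x1))).
      by ring.
    by rewrite area0; ring.
  transitivity (2 * ((e1 - x1) * (z1 - x1) + (e2 - x2) * (z2 - x2)) * (y2 - x2) +
    2 * (e1 - x1) * ((y1 - x1) * (z2 - x2) + - (y2 - x2) * (z1 - x1))).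
    by ring.
  by rewrite area0; ring.
have yx0 : sqn (y - x) != 0 by apply/eqP => /sqn_eq0/subr0_eq/esym.
have zx0 : sqn (z - x) != 0 by apply/eqP => /sqn_eq0/subr0_eq/esym.
have /(mulIf (mulf_neq0 yx0 zx0)) nE :
    sqn (y - x) * (sqn (y - x) * sqn (z - x)) = sqn (z - x) * (sqn (y - x) * sqn (z - x)).
  by move/(congr1 (@sqn R)): prop; rewrite !sqnM !sqnC => prop; rewrite mulrA -expr2 prop; ring.
move: prop; rewrite nE => /mulfI prop.
apply: yz; apply: (addIr (- x)); apply/esym/prop.
by rewrite (fmorph_eq0 (real_complex R)).
Qed.

Lemma kernel_det (R : realType) (d v w : R[i]) :
  complex.Im (v^*%C * w) != 0 -> complex.Im (d^*%C * v) = 0 -> complex.Im (d^*%C * w) = 0 ->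
  d = 0.
Proof.
case: d v w => [d1 d2] [v1 v2] [w1 w2] /= det0 dv dw.
apply/eqP; rewrite eq_complex /=; apply/andP; split; apply/eqP/(mulfI det0); rewrite mulr0.
  transitivity (v1 * (d1 * w2 + - d2 * w1) - w1 * (d1 * v2 + - d2 * v1)); first by ring.
  by rewrite dv dw !mulr0 subrr.
transitivity (v2 * (d1 * w2 + - d2 * w1) - w2 * (d1 * v2 + - d2 * v1)); first by ring.
by rewrite dv dw !mulr0 subrr.
Qed.

Lemma circle_through3 (R : realType) (e : R[i]) (r : {posnum R}) (D : ocircle R)
    (x y z : R[i]) :
  x <> y -> x <> z -> y <> z ->
  (forall t, t \in [:: x; y; z] -> points (OCircle e r true) (Some t)) ->
  (forall t, t \in [:: x; y; z] -> points D (Some t)) ->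
  points D = points (OCircle e r true).
Proof.
move=> xy xz yz xyzC xyzD.
have inx : x \in [:: x; y; z] by rewrite !inE eqxx.
have iny : y \in [:: x; y; z] by rewrite !inE eqxx orbT.
have inz : z \in [:: x; y; z] by rewrite !inE eqxx !orbT.
have Con t : t \in [:: x; y; z] -> sqn (t - e) = r%:num ^+ 2.
  by move=> /xyzC /on_circle ->.
have area0 : signed_area x y z != 0 by apply: (@not_collinear _ e) => //; rewrite !Con.
case: D xyzD => [e' r' o|p u u0] xyzD.
  have Don t : t \in [:: x; y; z] -> sqn (t - e') = r'%:num ^+ 2.
    by move=> /xyzD /on_circle ->.
  have ee' : e' = e.
    (* Subtracting the two circle equations makes [e' - e] orthogonal to the chords; the factor ['i]
       turns this into the vanishing imaginary parts of [kernel_det]. *)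
    suff : 'i%C * (e' - e) = 0.
      move/eqP; rewrite mulf_eq0 subr_eq0 => /orP[|/eqP//].
      by rewrite eq_complex /= oner_eq0 andbF.
    have ortho t : t \in [:: x; y; z] -> complex.Im (('i%C * (e' - e))^*%C * (t - x)) = 0.
      move=> tin; move: (Con _ inx) (Don _ inx) (Con _ tin) (Don _ tin).
      case: (x) (t) (e) (e') => [x1 x2] [t1 t2] [e1 e2] [f1 f2]; rewrite /sqn /=; lra.
    apply: (kernel_det area0); exact: ortho.
  have rr' : r'%:num = r%:num.
    apply/eqP; rewrite -(@eqrXn2 _ 2) //; apply/eqP.
    by rewrite -(Don _ inx) ee' (Con _ inx).
  by rewrite /= ee' rr'.
case/eqP: (u0); apply: (kernel_det area0).
  move: (xyzD _ inx) (xyzD _ iny); rewrite /= => h1 h2.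
  have -> : y - x = (y - p) - (x - p) by ring.
  by rewrite mulrBr raddfB /= h1 h2 subrr.
move: (xyzD _ inx) (xyzD _ inz); rewrite /= => h1 h2.
have -> : z - x = (z - p) - (x - p) by ring.
by rewrite mulrBr raddfB /= h1 h2 subrr.
Qed.
(** * Angles at the center *)

(* The hypothesis says that [x1] to [x2] is an arc of at least half a turn, whose complement
   contains [y1] and [y2]. *)
Lemma reflex_arc (R : realType) (x1 x2 y1 y2 : R[i]) : sqn x1 = 1 -> sqn x2 = 1 ->
  complex.Im (x1^*%C * x2) <= 0 ->
  0 < signed_area x1 x2 y1 + signed_area x1 x2 y2 ->
  x1 + x2 != 0 ->
  sqn (x1 + x2) < complex.Re ((x1 + x2)^*%C * (y1 + y2)).
Proof.
move=> nx1 nx2 cle S0 s0.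
have Ns0 : 0 < sqn (x1 + x2).
  by rewrite lt_neqAle sqn_ge0 andbT eq_sym; apply: contra s0 => /eqP/sqn_eq0 ->.
(* For unit vectors the chord [x2 - x1] is [2 I i (x1 + x2) / |x1 + x2|^2], where [I] is the
   imaginary part of [x1^* x2]. *)
have key : sqn (x1 + x2) *
    (signed_area x1 x2 y1 + signed_area x1 x2 y2 - 2 * complex.Im (x1^*%C * x2)) =
    - 2 * complex.Im (x1^*%C * x2) * complex.Re ((x1 + x2)^*%C * (y1 + y2)).
  move: nx1 nx2; case: (x1) (x2) (y1) (y2) => [a b] [c d] [e f] [g h].
  rewrite /sqn /signed_area /= => nx1 nx2.
  have a2 : a ^+ 2 = 1 - b ^+ 2 by rewrite -nx1 addrK.
  have c2 : c ^+ 2 = 1 - d ^+ 2 by rewrite -nx2 addrK.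
  ring: a2 c2.
move: cle S0 Ns0 key; set I := complex.Im _; set S := (_ + signed_area _ _ _).
set n := sqn _; set v := complex.Re _.
move=> Ile S0 n0 key; rewrite ltNge; apply/negP => vn.
have := mulr_gt0 n0 S0; have : 0 <= - I * (n - v) by rewrite mulr_ge0 ?subr_ge0 ?oppr_ge0.
nra.
Qed.

(** Were both arcs reflex, adding the two inequalities of [reflex_arc] would give
    [|(x1 + x2) - (y1 + y2)|^2 < 0]. Antipodal endpoints are treated directly. *)
Lemma two_reflex_arcs (R : realType) (x1 x2 y1 y2 : R[i]) :
  sqn x1 = 1 -> sqn x2 = 1 -> sqn y1 = 1 -> sqn y2 = 1 ->
  complex.Im (x1^*%C * x2) <= 0 ->
  0 < signed_area x1 x2 y1 + signed_area x1 x2 y2 ->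
  0 < signed_area y1 y2 x1 + signed_area y1 y2 x2 ->
  0 < complex.Im (y1^*%C * y2).
Proof.
move=> nx1 nx2 ny1 ny2 cx Sx Sy; rewrite ltNge; apply/negP => cy.
have [sx0|sx0] := eqVneq (x1 + x2) 0.
  have : signed_area y1 y2 x1 + signed_area y1 y2 x2 <= 0.
    have -> : x2 = - x1 by apply/eqP; rewrite -addr_eq0 addrC sx0.
    move: cy; rewrite /signed_area; case: (y1) (y2) (x1) => [a b] [c d] [e f] /=; lra.
  by rewrite leNgt Sy.
have [sy0|sy0] := eqVneq (y1 + y2) 0.
  have : signed_area x1 x2 y1 + signed_area x1 x2 y2 <= 0.
    have -> : y2 = - y1 by apply/eqP; rewrite -addr_eq0 addrC sy0.
    move: cx; rewrite /signed_area; case: (x1) (x2) (y1) => [a b] [c d] [e f] /=; lra.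
  by rewrite leNgt Sx.
have := reflex_arc nx1 nx2 cx Sx sx0; have := reflex_arc ny1 ny2 cy Sy sy0.
have := sqn_ge0 ((x1 + x2) - (y1 + y2)).
case: (x1 + x2) (y1 + y2) => [a b] [c d]; rewrite /sqn /=; lra.
Qed.

(** The law of cosines gives the cosine [(1 - t^2) / (1 + t^2)] of the angle from [u] to [u']; the
    positive imaginary part selects the sine [2 t / (1 + t^2)]. *)
Lemma turn_at_contact (R : realType) (u u' : R[i]) (r r' t : R) :
  0 < r -> 0 < r' -> 0 < t -> t ^+ 2 * (1 + r + r') = r * r' ->
  sqn u = 1 -> sqn u' = 1 -> sqn ((1 + r')%:C * u' - (1 + r)%:C * u) = (r + r') ^+ 2 ->
  0 < complex.Im (u^*%C * u') ->
  u' * (1 - 'i%C * t%:C) = u * (1 + 'i%C * t%:C).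
Proof.
move=> r0 r'0 t0 tE nu nu' nd.
have Du : u^*%C * u' = (complex.Re (u^*%C * u')) +i* (complex.Im (u^*%C * u')) by case: (_ * _).
have n1 : complex.Re (u^*%C * u') ^+ 2 + complex.Im (u^*%C * u') ^+ 2 = 1.
  have -> : complex.Re (u^*%C * u') ^+ 2 + complex.Im (u^*%C * u') ^+ 2 = sqn u * sqn u'.
    by case: (u) (u') => [a b] [c d]; rewrite /sqn /=; ring.
  by rewrite nu nu' mulr1.
have dot : (1 + r) * (1 + r') * complex.Re (u^*%C * u') = (1 + r) * (1 + r') - 2 * (r * r').
  have : sqn ((1 + r')%:C * u' - (1 + r)%:C * u) =
    (1 + r') ^+ 2 * sqn u' + (1 + r) ^+ 2 * sqn u -
    2 * ((1 + r) * (1 + r') * complex.Re (u^*%C * u')).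
    by case: (u) (u') => [a b] [c d]; rewrite /sqn /=; ring.
  by rewrite nd nu nu'; lra.
have uuE : u * (u^*%C * u') = u' by rewrite mulrA -sqnE nu mul1r.
move: Du n1 dot uuE; set D := complex.Re _; set S := complex.Im _ => -> n1 dot uuE S0.
have s0 : 1 + r + r' != 0 by rewrite gt_eqF // !addr_gt0.
have DE : D * (1 + t ^+ 2) = 1 - t ^+ 2.
  by apply: (mulIf s0); rewrite mulrBl -mulrA mulrDl tE; nra.
have SE : S * (1 + t ^+ 2) = 2 * t.
  apply/eqP; rewrite -(@eqrXn2 _ 2) ?mulr_ge0 ?(ltW S0) ?(ltW t0) ?addr_ge0 ?sqr_ge0 //.
  have -> : (S * (1 + t ^+ 2)) ^+ 2 =
      (D ^+ 2 + S ^+ 2) * (1 + t ^+ 2) ^+ 2 - (D * (1 + t ^+ 2)) ^+ 2 by ring.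
  by rewrite n1 DE; apply/eqP; ring.
rewrite -uuE -mulrA; congr (_ * _).
have t20 : 1 + t ^+ 2 != 0 by rewrite gt_eqF // ltr_pwDl ?sqr_ge0.
apply/eqP; rewrite eq_complex /=; apply/andP; split; apply/eqP/(mulIf t20).
  transitivity (D * (1 + t ^+ 2) + S * (1 + t ^+ 2) * t); first by ring.
  by rewrite DE SE; ring.
transitivity (S * (1 + t ^+ 2) - D * (1 + t ^+ 2) * t); first by ring.
by rewrite DE SE; ring.
Qed.

(* [t1], [t2], [t3] are the tangents of three angles of sum a right angle. *)
Lemma half_turn (F : fieldType) (i t1 t2 t3 : F) : i ^+ 2 = -1 ->
  t1 * t2 + t1 * t3 + t2 * t3 = 1 ->
  (1 - i * t1) * (1 - i * t2) * (1 - i * t3) = - ((1 + i * t1) * (1 + i * t2) * (1 + i * t3)).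
Proof.
move=> i2 tE.
have h : t1 * t2 = 1 - t1 * t3 - t2 * t3 by rewrite -tE; ring.
ring: i2 h.
Qed.

Lemma half_turn_neq0 (R : realType) (t : R) : (1 - 'i%C * t%:C != 0) * (1 + 'i%C * t%:C != 0).
Proof.
by split; apply/eqP => /(congr1 (@complex.Re R)) /=; lra.
Qed.

(** * The normalised flower *)

Section Flower.
Variables (R : realType) (r t : 'Z_6 -> R) (u : 'Z_6 -> R[i]).
Hypotheses (r0 : forall k, 0 < r k) (t0 : forall k, 0 < t k)
  (rE : forall k, r k * r (k + 2) = r (k + 1))
  (tE : forall k, t k ^+ 2 * (1 + r k + r (k + 1)) = r k * r (k + 1))
  (tr : forall k, t (k + 2) * r k = t k)
  (nu : forall k, sqn (u k) = 1)
  (dist : forall k,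
    sqn ((1 + r (k + 1))%:C * u (k + 1) - (1 + r k)%:C * u k) = (r k + r (k + 1)) ^+ 2)
  (area : forall k l, l != k -> l != k + 1 -> 0 < signed_area (u k) (u (k + 1)) (u l)).

(** No contact lies to the right of the chord from [u a] to [u (a + 1)], and for [b != a] one of
    [u b], [u (b + 1)] lies strictly to its left, so [two_reflex_arcs] applies. *)
Lemma one_reflex_arc k j : j != k -> complex.Im ((u k)^*%C * u (k + 1)) <= 0 ->
  0 < complex.Im ((u j)^*%C * u (j + 1)).
Proof.
have areal a l : 0 <= signed_area (u a) (u (a + 1)) (u l).
  have [->|la] := eqVneq l a; first by rewrite /signed_area subrr mulr0.
  have [->|la'] := eqVneq l (a + 1); last exact/ltW/area.
  by rewrite /signed_area; case: (u _) (u _) => [b c] [d e] /=; lra.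
have sum a b : b != a ->
    0 < signed_area (u a) (u (a + 1)) (u b) + signed_area (u a) (u (a + 1)) (u (b + 1)).
  move=> ba; have [ba1|ba1] := eqVneq b (a + 1); last by apply: ltr_wpDr; rewrite ?area.
  apply: ltr_wpDl => //; apply: area; rewrite ba1 -subr_eq0.
    by have -> : a + 1 + 1 - a = 2 by ring.
  by have -> : a + 1 + 1 - (a + 1) = 1 by ring.
by move=> jk; move/two_reflex_arcs; apply; rewrite ?sum // eq_sym.
Qed.

Lemma r_opp k : r k * r (k + 3) = 1.
Proof.
have := rE (k + 1); have := rE k.
have -> : k + 1 + 2 = k + 3 by ring. have -> : k + 1 + 1 = k + 2 by ring.
move=> e1 e2; have nz : r (k + 1) * r (k + 2) != 0 by rewrite mulf_neq0 ?gt_eqF.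
apply: (mulIf nz).
transitivity ((r k * r (k + 2)) * (r (k + 1) * r (k + 3))); first by ring.
by rewrite e1 e2 mul1r.
Qed.

(** Alternate half-angles add up to a right angle. By [tr] every term is a multiple of
    [t (k + 4) ^+ 2], which [tE] evaluates. *)
Lemma t_sum k : t k * t (k + 2) + t k * t (k + 4) + t (k + 2) * t (k + 4) = 1.
Proof.
have := tr (k + 2); have := tr k; have := r_opp (k + 1); have := r_opp (k + 2).
have := rE k; have := tE (k + 4).
have -> : k + 2 + 2 = k + 4 by ring. have -> : k + 2 + 3 = k + 4 + 1 by ring.
have -> : k + 1 + 3 = k + 4 by ring.
move=> eT e0 e2 e1 t2 t4; rewrite -t2 -t4.
have nz : r (k + 1) * r (k + 2) != 0 by rewrite mulf_neq0 ?gt_eqF.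
transitivity (t (k + 4) ^+ 2 * ((r k * r (k + 2)) * r (k + 2) + (r k * r (k + 2)) + r (k + 2))).
  by ring.
rewrite e0.
transitivity (r (k + 1) * r (k + 2) * (t (k + 4) ^+ 2 * (1 + r (k + 4) + r (k + 4 + 1)))).
  transitivity (t (k + 4) ^+ 2 * (r (k + 1) * r (k + 2) +
    r (k + 2) * (r (k + 1) * r (k + 4)) + r (k + 1) * (r (k + 2) * r (k + 4 + 1)))); last by ring.
  by rewrite e1 e2; ring.
rewrite eT; transitivity ((r (k + 1) * r (k + 4)) * (r (k + 2) * r (k + 4 + 1))); first by ring.
by rewrite e1 e2 mulr1.
Qed.

(* If the step at [k] were at least half a turn, the five other steps would be as claimed, and they
   determine this one since the six turns multiply to 1. *)
Lemma turn k : u (k + 1) * (1 - 'i%C * (t k)%:C) = u k * (1 + 'i%C * (t k)%:C).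
Proof.
have step j : 0 < complex.Im ((u j)^*%C * u (j + 1)) ->
    u (j + 1) * (1 - 'i%C * (t j)%:C) = u j * (1 + 'i%C * (t j)%:C).
  exact: (@turn_at_contact _ _ _ (r j) (r (j + 1))).
have [/step //|cle] := ltrP 0 (complex.Im ((u k)^*%C * u (k + 1))).
have {}step j (jk : j != k) := step j (one_reflex_arc jk cle).
have ne m : m != 0 -> k + m != k by rewrite -[X in _ -> _ != X]addr0 (inj_eq (addrI k)).
have := step _ (ne 1 isT); have := step _ (ne 2 isT); have := step _ (ne 3 isT).
have := step _ (ne 4 isT); have := step _ (ne 5 isT).
have -> : k + 5 + 1 = k by rewrite -addrA -[RHS]addr0; congr (_ + _); apply/val_inj.
have -> : k + 4 + 1 = k + 5 by ring. have -> : k + 3 + 1 = k + 4 by ring.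
have -> : k + 2 + 1 = k + 3 by ring. have -> : k + 1 + 1 = k + 2 by ring.
have i2 := sqr_i R.
have castsum j : (t j)%:C * (t (j + 2))%:C + (t j)%:C * (t (j + 4))%:C +
    (t (j + 2))%:C * (t (j + 4))%:C = 1 :> R[i].
  by rewrite -!rmorphM -!rmorphD t_sum.
have := half_turn i2 (castsum k); have := half_turn i2 (castsum (k + 1)).
have -> : k + 1 + 2 = k + 3 by ring. have -> : k + 1 + 4 = k + 5 by ring.
have nz j := (half_turn_neq0 (t j)).2.
pose A j := 1 - 'i%C * (t j)%:C; pose B j := 1 + 'i%C * (t j)%:C.
have : B (k + 1) * B (k + 2) * B (k + 3) * B (k + 4) * B (k + 5) != 0.
  by rewrite !mulf_neq0 ?nz.
rewrite -!/(A _) -!/(B _); move: (A) (B) => {}A {}B.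
move: (u (k + 1)) (u (k + 2)) (u (k + 3)) (u (k + 4)) (u (k + 5)) => u1 u2 u3 u4 u5.
move: (A (k + 1)) (A (k + 2)) (A (k + 3)) (A (k + 4)) (A (k + 5)) (A k) => A1 A2 A3 A4 A5 A0.
move: (B (k + 1)) (B (k + 2)) (B (k + 3)) (B (k + 4)) (B (k + 5)) (B k) => B1 B2 B3 B4 B5 B0.
move=> B_neq0 odd even e5 e4 e3 e2 e1.
(* The five known steps are chained from [u1] round to [u k]; the two alternating triples then each
   contribute a sign -1. *)
apply: (mulIf B_neq0).
transitivity ((u1 * B1) * B2 * B3 * B4 * B5 * A0); first by ring.
rewrite -e1; transitivity ((u2 * B2) * B3 * B4 * B5 * A0 * A1); first by ring.
rewrite -e2; transitivity ((u3 * B3) * B4 * B5 * A0 * A1 * A2); first by ring.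
rewrite -e3; transitivity ((u4 * B4) * B5 * A0 * A1 * A2 * A3); first by ring.
rewrite -e4; transitivity ((u5 * B5) * A0 * A1 * A2 * A3 * A4); first by ring.
rewrite -e5; transitivity (u k * (A0 * A2 * A4) * (A1 * A3 * A5)); first by ring.
by rewrite odd even; ring.
Qed.

(* In what follows [j] is the index preceding that of the petal in question. *)
Definition tangent_a j := t (j + 2).
(** [j + 5] stands for [j - 1], so that [a j * b j] is the invariant [g]. *)
Definition tangent_b j := t (j + 5).
Local Notation a := tangent_a.
Local Notation b := tangent_b.
Definition scale j := (1 + r (j + 1)) / (1 - (a j * b j) ^+ 2).
(** The number [X (j + 1)], written rationally in the half-angle tangents. *)
Definition spoke j : R[i] :=
  (scale j)%:C * (a j)%:C * (b j)%:C * (1 + 'i%C * (b j)%:C) * (1 - 'i%C * (a j)%:C).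
(** The center [e (j + 1)] of the s-circle, not of the petal. *)
Definition center j : R[i] :=
  u (j + 1) * (1 - 'i%C * (t j)%:C) * (1 + 'i%C * (t (j + 1))%:C) / (1 + a j * b j)%:C.
Definition common_point j : R[i] := center j - u (j + 1) * (spoke j)^*%C.
(** The point dividing the segment between the petal centers [(1 + r k) u k] and
    [(1 + r (k + 1)) u (k + 1)] in the ratio [r k : r (k + 1)]. *)
Definition outer_contact k : R[i] :=
  ((1 + r k) * r (k + 1))%:C / (r k + r (k + 1))%:C * u k +
  (r k * (1 + r (k + 1)))%:C / (r k + r (k + 1))%:C * u (k + 1).

(** * Radii and tangents in the frame of a petal *)

Lemma frame_t0 j : t j = a j * r j.
Proof. by rewrite tr. Qed.

Lemma frame_t1 j : t (j + 1) = b j * r (j + 2).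
Proof.
rewrite -(tr (j + 1)) -(tr (j + 1 + 2)) /b.
have -> : j + 1 + 2 + 2 = j + 5 by ring. have -> : j + 1 + 2 = j + 1 + 1 + 1 by ring.
rewrite -mulrA; congr (_ * _); have := rE (j + 1); rewrite mulrC.
have -> : j + 1 + 2 = j + 1 + 1 + 1 by ring. have -> // : j + 1 + 1 = j + 2 by ring.
Qed.

Lemma frame_rel1 j : a j ^+ 2 * (1 + r j + r j * r (j + 2)) = r (j + 2).
Proof.
have := tE j; rewrite {1}frame_t0 -rE => e.
have r2 : r j ^+ 2 != 0 by rewrite expf_neq0 ?gt_eqF.
by apply: (mulIf r2); transitivity (r j * (r j * r (j + 2))); [rewrite -e; ring|ring].
Qed.

Lemma frame_rel2 j : b j ^+ 2 * (1 + r (j + 2) + r j * r (j + 2)) = r j.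
Proof.
have := tE (j + 1); rewrite {1}frame_t1.
have -> : j + 1 + 1 = j + 2 by ring.
rewrite -rE => e.
have r2 : r (j + 2) ^+ 2 != 0 by rewrite expf_neq0 ?gt_eqF.
by apply: (mulIf r2); transitivity (r j * r (j + 2) * r (j + 2)); [rewrite -e; ring|ring].
Qed.

(** For a given product [x y], [frame_rel1] and [frame_rel2] are a linear system in [x], [y] of
    determinant [1 - (a b)^2]; the determinant is positive because [x] and the right-hand side of
    [xE] are. *)
Lemma frame_param j : [/\ 0 < 1 - (a j * b j) ^+ 2,
  r j = scale j * b j ^+ 2 * (1 + a j ^+ 2),
  r (j + 2) = scale j * a j ^+ 2 * (1 + b j ^+ 2) &
  1 + r j * r (j + 2) = scale j * (1 - (a j * b j) ^+ 2)].
Proof.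
rewrite /scale -(rE j); have := frame_rel1 j; have := frame_rel2 j.
have : 0 < a j by exact: t0. have : 0 < b j by exact: t0.
move: (a j) (b j) (r j) (r (j + 2)) (r0 j) (r0 (j + 2)) => A B x y x0 y0 B0 A0 h2 h1.
have xE : x * (1 - (A * B) ^+ 2) = (1 + x * y) * B ^+ 2 * (1 + A ^+ 2).
  transitivity (B ^+ 2 * (1 + y + x * y) - B ^+ 2 * A ^+ 2 * x); first by rewrite h2; ring.
  transitivity ((1 + x * y) * B ^+ 2 * (1 + A ^+ 2) + B ^+ 2 * (y - A ^+ 2 * (1 + x + x * y))).
    by ring.
  by rewrite h1 subrr mulr0 addr0.
have yE : y * (1 - (A * B) ^+ 2) = (1 + x * y) * A ^+ 2 * (1 + B ^+ 2).
  transitivity (A ^+ 2 * (1 + x + x * y) - B ^+ 2 * A ^+ 2 * y); first by rewrite h1; ring.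
  transitivity ((1 + x * y) * A ^+ 2 * (1 + B ^+ 2) + A ^+ 2 * (x - B ^+ 2 * (1 + y + x * y))).
    by ring.
  by rewrite h2 subrr mulr0 addr0.
have g0 : 0 < 1 - (A * B) ^+ 2.
  by rewrite -(pmulr_rgt0 _ x0) xE !mulr_gt0 ?exprn_gt0 ?addr_gt0 ?mulr_gt0 ?exprn_gt0.
have gn := lt0r_neq0 g0.
split=> //; last by rewrite divfK.
  by apply: (mulIf gn); rewrite xE; field.
by apply: (mulIf gn); rewrite yE; field.
Qed.

Lemma frame_paramC j : [/\ 1 - ((a j)%:C * (b j)%:C) ^+ 2 != 0,
  (r j)%:C = (scale j)%:C * (b j)%:C ^+ 2 * (1 + (a j)%:C ^+ 2),
  (r (j + 2))%:C = (scale j)%:C * (a j)%:C ^+ 2 * (1 + (b j)%:C ^+ 2) &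
  1 + (r j)%:C * (r (j + 2))%:C = (scale j)%:C * (1 - ((a j)%:C * (b j)%:C) ^+ 2)].
Proof.
have [g0 xE yE xyE] := frame_param j; split.
- have -> : 1 - ((a j)%:C * (b j)%:C) ^+ 2 = (1 - (a j * b j) ^+ 2)%:C by ring.
  by rewrite (fmorph_eq0 (real_complex R)) gt_eqF.
- by rewrite {1}xE; ring.
- by rewrite {1}yE; ring.
- by transitivity ((1 + r j * r (j + 2))%:C); [ring | rewrite xyE; ring].
Qed.

Lemma real_complex_neq0 (z : R) : 0 < z -> z%:C != 0.
Proof. by move=> z0; rewrite (fmorph_eq0 (real_complex R)) gt_eqF. Qed.

Lemma centerE j : center j * (1 + (a j)%:C * (b j)%:C) =
  u (j + 1) * (1 - 'i%C * ((a j)%:C * (r j)%:C)) * (1 + 'i%C * ((b j)%:C * (r (j + 2))%:C)).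
Proof.
rewrite -!(rmorphM (real_complex R)) /= -frame_t0 -frame_t1.
rewrite -(rmorph1 (real_complex R)) -rmorphD /=.
by rewrite divfK // real_complex_neq0 // addr_gt0 ?mulr_gt0 ?t0.
Qed.

Lemma one_plus_g_neq0 j : 1 + (a j)%:C * (b j)%:C != 0.
Proof.
rewrite -(rmorphM (real_complex R)) -(rmorph1 (real_complex R)) -rmorphD real_complex_neq0 //.
by rewrite addr_gt0 ?mulr_gt0 ?t0.
Qed.

(** * Points on the circle about each [center j] *)

Lemma next_contact j : outer_contact (j + 1) = center j + spoke j * u (j + 2).
Proof.
have [g0 xE yE xyE] := frame_paramC j.
have := turn (j + 1); have -> : j + 1 + 1 = j + 2 by ring.
rewrite frame_t1 (rmorphM (real_complex R)) /= => uE.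
have nz := (half_turn_neq0 (t (j + 1))).1.
rewrite frame_t1 (rmorphM (real_complex R)) /= in nz.
apply: (contact_from_center (sqr_i R) xE yE xyE _ (one_plus_g_neq0 j) nz uE _ (centerE j)).
  by rewrite -(rmorph1 (real_complex R)) -rmorphD real_complex_neq0 ?addr_gt0.
rewrite /outer_contact; have -> : j + 1 + 1 = j + 2 by ring.
rewrite -rE.
have nz' : (r j)%:C * (r (j + 2))%:C + (r (j + 2))%:C != 0.
  by rewrite -(rmorphM (real_complex R)) -rmorphD real_complex_neq0 ?addr_gt0 ?mulr_gt0.
by field; exact: nz'.
Qed.

Lemma prev_contact j : outer_contact j = center j + spoke j * u j.
Proof.
have [g0 xE yE xyE] := frame_paramC j.
(* Mirror image of the next contact: [-'i] replaces ['i] and the two neighbours are exchanged. *)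
have Ni2 : (- 'i%C) ^+ 2 = -1 :> R[i] by rewrite sqrrN sqr_i.
have := turn j; rewrite frame_t0 (rmorphM (real_complex R)) /= => uE.
have nz := (half_turn_neq0 (t j)).2; rewrite frame_t0 (rmorphM (real_complex R)) /= in nz.
have xyE' : 1 + (r (j + 2))%:C * (r j)%:C = (scale j)%:C * (1 - ((b j)%:C * (a j)%:C) ^+ 2).
  by rewrite mulrC xyE; ring.
have -> : spoke j =
    (scale j)%:C * (b j)%:C * (a j)%:C * (1 + - 'i%C * (a j)%:C) * (1 - - 'i%C * (b j)%:C).
  by rewrite /spoke; ring.
apply: (contact_from_center (u := u (j + 1)) Ni2 yE xE xyE').
- by rewrite -(rmorph1 (real_complex R)) -rmorphD real_complex_neq0 ?addr_gt0.
- by rewrite mulrC one_plus_g_neq0.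
- by rewrite mulNr opprK.
- by rewrite !mulNr opprK uE.
- rewrite /outer_contact -rE.
  have nz' : (r j)%:C + (r j)%:C * (r (j + 2))%:C != 0.
    by rewrite -(rmorphM (real_complex R)) -rmorphD real_complex_neq0 ?addr_gt0 ?mulr_gt0.
  by field; exact: nz'.
- by rewrite mulrC [_ * (a j)%:C]mulrC mulrC centerE; ring.
Qed.

Lemma sqn_spoke j : sqn (spoke j) = r (j + 1).
Proof.
have [_ xE yE _] := frame_param j.
rewrite /spoke !sqnM !sqnC -rE {1}xE {1}yE /sqn /=; ring.
Qed.

Lemma conjcM (z w : R[i]) : (z * w)^*%C = z^*%C * w^*%C.
Proof. exact: rmorphM. Qed.

Lemma conjcD (z w : R[i]) : (z + w)^*%C = z^*%C + w^*%C.
Proof. exact: rmorphD. Qed.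

Lemma conjcN (z : R[i]) : (- z)^*%C = - z^*%C.
Proof. exact: rmorphN. Qed.

Lemma conj_i1 (z w : R) :
  ((1 + 'i%C * (z%:C * w%:C))^*%C = 1 - 'i%C * (z%:C * w%:C)) *
  ((1 - 'i%C * (z%:C * w%:C))^*%C = 1 + 'i%C * (z%:C * w%:C)).
Proof.
by split; apply/eqP; rewrite eq_complex /=; apply/andP; split; apply/eqP; ring.
Qed.

Lemma conj_centerE j : (center j)^*%C * (1 + (a j)%:C * (b j)%:C) =
  (u (j + 1))^*%C * (1 + 'i%C * ((a j)%:C * (r j)%:C)) *
    (1 - 'i%C * ((b j)%:C * (r (j + 2))%:C)).
Proof.
have /(congr1 conjc) := centerE j; rewrite !conjcM !conj_i1 => <-.
congr (_ * _); apply/eqP; rewrite eq_complex /=.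
by apply/andP; split; apply/eqP; ring.
Qed.

Lemma unit_conj k : u k * (u k)^*%C = 1.
Proof. by rewrite -sqnE nu. Qed.

Lemma next_dist j : sqn (u (j + 2) - center j) = r (j + 1).
Proof.
have [g0 xE yE xyE] := frame_paramC j.
have := turn (j + 1); have -> : j + 1 + 1 = j + 2 by ring.
have := half_turn_neq0 (t (j + 1)).
rewrite frame_t1 (rmorphM (real_complex R)) /= => -[nz nz'] uE.
have uE' := congr1 conjc uE; rewrite !conjcM !conj_i1 in uE'.
apply: (@complexI R); rewrite sqnE -rE conjcD conjcN (rmorphM (real_complex R)).
exact: (contact_center_dist (sqr_i R) xE yE xyE (one_plus_g_neq0 j) nz nz' (unit_conj _)
  uE uE' (centerE j) (conj_centerE j)).
Qed.

Lemma prev_dist j : sqn (u j - center j) = r (j + 1).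
Proof.
have [g0 xE yE xyE] := frame_paramC j.
have Ni2 : (- 'i%C) ^+ 2 = -1 :> R[i] by rewrite sqrrN sqr_i.
have xyE' : 1 + (r (j + 2))%:C * (r j)%:C = (scale j)%:C * (1 - ((b j)%:C * (a j)%:C) ^+ 2).
  by rewrite mulrC xyE; ring.
have := turn j; have := half_turn_neq0 (t j).
rewrite frame_t0 (rmorphM (real_complex R)) /= => -[nz nz'] uE.
have uE' := congr1 conjc uE; rewrite !conjcM !conj_i1 in uE'.
apply: (@complexI R); rewrite sqnE -rE [r j * _]mulrC conjcD conjcN (rmorphM (real_complex R)).
apply: (contact_center_dist (u := u (j + 1)) (v := (u (j + 1))^*%C ) Ni2 yE xE xyE').
- by rewrite mulrC one_plus_g_neq0.
- by rewrite mulNr opprK.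
- by rewrite mulNr.
- exact: unit_conj.
- by rewrite !mulNr opprK uE.
- by rewrite !mulNr opprK uE'.
- by have := centerE j; rewrite !mulNr opprK [(b j)%:C * (a j)%:C]mulrC => ->; ring.
- by have := conj_centerE j; rewrite !mulNr opprK [(b j)%:C * (a j)%:C]mulrC => ->; ring.
Qed.

Lemma common_dist j : sqn (common_point j - center j) = r (j + 1).
Proof.
have -> : common_point j - center j = - (u (j + 1) * (spoke j)^*%C).
  by rewrite /common_point; ring.
apply: (@complexI R); rewrite sqnE conjcN (conjcM (u _)) conjcK.
transitivity ((u (j + 1) * (u (j + 1))^*%C ) * (spoke j * (spoke j)^*%C )); first by ring.
by rewrite unit_conj mul1r -sqnE sqn_spoke.
Qed.

Lemma conj_spoke j : (spoke j)^*%C =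
  (scale j)%:C * (a j)%:C * (b j)%:C * (1 - 'i%C * (b j)%:C) * (1 + 'i%C * (a j)%:C).
Proof.
by apply/eqP; rewrite /spoke eq_complex /=; apply/andP; split; apply/eqP; ring.
Qed.

(** * Independence of the common point from the petal *)

Lemma common_pointE j : common_point j * (1 + (a j)%:C * (b j)%:C) =
  u (j + 1) * (1 - (a j)%:C * (b j)%:C - 2 * ((a j)%:C * (b j)%:C) * (spoke j)^*%C ).
Proof.
have [g0 xE yE xyE] := frame_paramC j.
by rewrite /common_point conj_spoke (common_point_form (sqr_i R) xE yE xyE (centerE j)).
Qed.

(** By [tr] the two products differ by the factor [r j * r (j + 3)], which is 1. *)
Lemma g_const j : a (j + 1) * b (j + 1) = a j * b j.
Proof.
rewrite /a /b; have := tr j; have := tr (j + 3); have := r_opp j.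
have -> : j + 3 + 2 = j + 5 by ring. have -> : j + 1 + 2 = j + 3 by ring.
have -> : j + 1 + 5 = j by rewrite -addrA -[RHS]addr0; congr (_ + _); apply/val_inj.
by move=> rr <- <-; rewrite -[RHS]mulr1 -rr; ring.
Qed.

(** In the form of [common_pointE], the turn from [u (j + 1)] to [u (j + 2)] compensates the change
    of the bracket computed in [common_point_form_next]. *)
Lemma common_point_step j : common_point (j + 1) = common_point j.
Proof.
have [g0 xE yE xyE] := frame_paramC j.
have [g0' _ yE' xyE'] := frame_paramC (j + 1).
have ab : (a (j + 1))%:C * (b (j + 1))%:C = (a j)%:C * (b j)%:C.
  by rewrite -!(rmorphM (real_complex R)) /= g_const.
have x0 := real_complex_neq0 (r0 j).
have j6 : j + 1 + 5 = j by rewrite -addrA -[RHS]addr0; congr (_ + _); apply/val_inj.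
have bE : (b (j + 1))%:C = (a j)%:C * (r j)%:C.
  by rewrite -(rmorphM (real_complex R)) -frame_t0 /b j6.
have aE : (a (j + 1))%:C = (b j)%:C / (r j)%:C.
  have a0 : (a j)%:C != 0 by apply/real_complex_neq0/t0.
  by apply: (mulIf a0); apply: (mulIf x0); rewrite -mulrA -bE ab mulrAC divfK // mulrC.
have scE : (scale (j + 1))%:C * (1 - ((a j)%:C * (b j)%:C) ^+ 2) = 1 + (r (j + 2))%:C.
  rewrite -ab -xyE' -(rmorphM (real_complex R)) rE.
  by have -> : j + 1 + 1 = j + 2 by ring.
have nz := (half_turn_neq0 (t (j + 1))).1; have uE := turn (j + 1).
rewrite frame_t1 (rmorphM (real_complex R)) /= in nz uE.
apply: (mulIf (one_plus_g_neq0 j)); rewrite -{1}ab !common_pointE ab.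
apply: (mulIf nz); rewrite [LHS]mulrAC uE -[LHS]mulrA -[RHS]mulrA; congr (_ * _).
rewrite [RHS]mulrC !conj_spoke (common_point_form_next (sqr_i R) xE yE xyE x0 g0 scE).
by rewrite -[_ * (a (j + 1))%:C * _]mulrA ab aE bE !mulrA.
Qed.

Lemma common_point_const j k : common_point j = common_point k.
Proof.
have const (m : 'Z_6) : common_point m = common_point 0.
  have -> : m = (nat_of_ord m)%:R by rewrite natr_Zp.
  elim: (nat_of_ord m) => [//|n IHn].
  by rewrite -IHn -natr1 common_point_step.
by rewrite const [RHS]const.
Qed.

(** Equality would force the conjugate spoke to be -1, but its real part [s a b (1 + a b)] is
    positive. *)
Lemma common_point_neq j : common_point j <> u (j + 1).
Proof.
move=> pE; have := common_pointE j; rewrite pE => /mulfI.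
have u0 : u (j + 1) != 0.
  apply/eqP => u0; have := nu (j + 1); rewrite u0 /sqn /= => /eqP.
  by rewrite expr0n addr0 eq_sym oner_eq0.
move/(_ u0)/(congr1 (@complex.Re R)); rewrite conj_spoke.
have [g0 xE yE _] := frame_param j.
have s0 : 0 < scale j by apply: divr_gt0 => //; exact: addr_gt0.
have a0 : 0 < a j by apply: t0. have b0 : 0 < b j by apply: t0.
have := mulr_gt0 a0 b0; have := mulr_gt0 (mulr_gt0 s0 (exprn_gt0 2 a0)) (exprn_gt0 2 b0).
have := mulr_gt0 (mulr_gt0 s0 (exprn_gt0 3 a0)) (exprn_gt0 3 b0).
rewrite /=; nra.
Qed.

Lemma concentric_contacts : exists (e : 'Z_6 -> R[i]) (p : R[i]), forall k,
  p <> u k /\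
  [/\ sqn (u (k - 1) - e k) = r k, sqn (u (k + 1) - e k) = r k,
    sqn (outer_contact k - e k) = r k, sqn (outer_contact (k - 1) - e k) = r k &
    sqn (p - e k) = r k].
Proof.
(* [center j] belongs to the petal [j + 1], whence the shift. *)
exists (fun k => center (k - 1)), (common_point 0) => k.
rewrite -(subrK 1 k); move: (k - 1) => j {k}; rewrite addrK.
have -> : j + 1 + 1 = j + 2 by ring.
rewrite (common_point_const 0 j); split; first exact: common_point_neq.
rewrite prev_dist next_dist common_dist next_contact prev_contact; split=> //.
  by rewrite addrAC subrr add0r sqnM sqn_spoke nu mulr1.
by rewrite addrAC subrr add0r sqnM sqn_spoke nu mulr1.
Qed.

End Flower.

(** * Doyle spirals *)

Lemma half_angle_tangents (R : realType) (r : 'Z_6 -> R) : (forall k, 0 < r k) ->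
  (forall k, r k * r (k + 2) = r (k + 1)) ->
  exists t : 'Z_6 -> R, [/\ forall k, 0 < t k,
    forall k, t k ^+ 2 * (1 + r k + r (k + 1)) = r k * r (k + 1) &
    forall k, t (k + 2) * r k = t k].
Proof.
(* Half-angle formula at 0 in the triangle with sides [1 + r k], [1 + r (k + 1)],
   [r k + r (k + 1)]. *)
move=> r0 rE; pose t k := Num.sqrt (r k * r (k + 1) / (1 + r k + r (k + 1))).
have d0 k : 0 < 1 + r k + r (k + 1) by rewrite !addr_gt0.
have t0 k : 0 < t k by rewrite sqrtr_gt0 divr_gt0 ?mulr_gt0.
have tE k : t k ^+ 2 * (1 + r k + r (k + 1)) = r k * r (k + 1).
  by rewrite sqr_sqrtr ?divfK ?gt_eqF // ltW // divr_gt0 ?mulr_gt0.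
exists t; split=> // k; apply/eqP.
rewrite -(@eqrXn2 _ 2) ?mulr_ge0 ?(ltW (t0 _)) ?(ltW (r0 _)) //; apply/eqP.
apply: (mulIf (lt0r_neq0 (d0 k))); rewrite tE.
have := tE (k + 2); have := rE k; have := r_opp r0 rE k.
have -> : k + 2 + 1 = k + 3 by ring.
move=> r3 r1 e.
transitivity (r k * (r k * (t (k + 2) ^+ 2 * (r k * 1 + r k * r (k + 2) + r k * r (k + 3))))).
  by rewrite r1 r3; ring.
transitivity (r k ^+ 3 * (t (k + 2) ^+ 2 * (1 + r (k + 2) + r (k + 3)))); first by ring.
rewrite e; transitivity (r k * (r k * r (k + 2)) * (r k * r (k + 3))); first by ring.
by rewrite r1 r3 mulr1.
Qed.

Lemma signed_area_rot (R : realType) (x y z : R[i]) : signed_area y z x = signed_area x y z.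
Proof. by case: x y z => [a b] [c d] [e f]; rewrite /signed_area /=; ring. Qed.

Lemma signed_area_affine (R : realType) (c : R[i]) (s : R) (x y z : R[i]) :
  signed_area (c + s%:C * x) (c + s%:C * y) (c + s%:C * z) = s ^+ 2 * signed_area x y z.
Proof. by case: c x y z => [a b] [d e] [f g] [h i]; rewrite /signed_area /=; ring. Qed.

(** A rotation of the triple, under which the area is invariant, makes the indices increasing;
    [k = 5] is separate since [k + 1] wraps to 0. *)
Lemma consecutive_area (R : realType) (u : 'Z_6 -> R[i]) :
  (forall i j k : 'Z_6, (i < j)%N -> (j < k)%N -> 0 < signed_area (u i) (u j) (u k)) ->
  forall k l, l != k -> l != k + 1 -> 0 < signed_area (u k) (u (k + 1)) (u l).
Proof.
move=> pos k l; rewrite -!val_eqE /= => lk lk1.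
have [k5|k5] := eqVneq (nat_of_ord k) 5.
  have k1 : nat_of_ord (k + 1) = 0%N by rewrite /= k5.
  rewrite k5 in lk lk1; rewrite -signed_area_rot; apply: pos; first by rewrite k1 lt0n.
  by rewrite k5 ltn_neqAle lk -ltnS (ltn_ord l).
have k1 : nat_of_ord (k + 1) = k.+1.
  by rewrite /= modn_small ?addn1 // ltn_neqAle (ltn_ord k) andbT eqSS.
have kk1 : (k < (k + 1)%R)%N by rewrite k1.
have [lltk|] := ltnP l k; first by rewrite signed_area_rot; apply: pos.
rewrite leq_eqVlt eq_sym (negPf lk) /= => kl; apply: pos => //.
by rewrite k1 ltn_neqAle kl andbT -k1 eq_sym.
Qed.

Lemma homothetic_circle (R : realType) (c e v : R[i]) (s d : R) (q : {posnum R}) :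
  0 < s -> q%:num = s * Num.sqrt d -> 0 <= d ->
  points (OCircle (c + s%:C * e) q true) (Some (c + s%:C * v)) <-> sqn (v - e) = d.
Proof.
move=> s0 qE d0; rewrite /= on_circle // qE.
have -> : c + s%:C * v - (c + s%:C * e) = s%:C * (v - e) by ring.
rewrite sqnM sqnC exprMn sqr_sqrtr //; split=> [|-> //].
by apply: mulfI; rewrite expf_neq0 // gt_eqF.
Qed.

(** The map [v] to [c + s v] carries the normalised flower to the given one, and
    [concentric_contacts] supplies the s-circles and their common point. *)
Lemma doyle_flower (R : realType) (C : ocircle R) (P : 'Z_6 -> ocircle R)
    (z w : 'Z_6 -> sphere R)
    (c : R[i]) (ck : 'Z_6 -> R[i]) (s : {posnum R}) (sk : 'Z_6 -> {posnum R}) :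
  C = OCircle c s true -> (forall k, P k = OCircle (ck k) (sk k) true) ->
  (forall k, (sk k)%:num * (sk (k + 3))%:num = s%:num ^+ 2) ->
  (forall k, (sk k)%:num * (sk (k + 2))%:num * (sk (k + 4))%:num = s%:num ^+ 3) ->
  flower C P z w -> s_circles_concurrent z w.
Proof.
move=> CE PE opp tri [zC zI zO wP].
pose r k := (sk k)%:num / s%:num.
have s0 : 0 < s%:num by [].
have sn : s%:num != 0 by [].
have skE k : (sk k)%:num = s%:num * r k by rewrite mulrC divfK.
have r0 k : 0 < r k by rewrite divr_gt0.
have ropp k : r k * r (k + 3) = 1.
  by apply: (mulfI (expf_neq0 2 sn)); rewrite mulr1 -[RHS](opp k) !skE; ring.
have rtri k : r k * r (k + 2) * r (k + 4) = 1.
  by apply: (mulfI (expf_neq0 3 sn)); rewrite mulr1 -[RHS](tri k) !skE; ring.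
(* In the triple product, [r (k + 4)] is the inverse of [r (k + 1)]. *)
have rE k : r k * r (k + 2) = r (k + 1).
  have := rtri k; have := ropp (k + 1); have -> : k + 1 + 3 = k + 4 by ring.
  move=> <- /mulIf -> //; exact: lt0r_neq0.
have [t [t0 tE tr]] := half_angle_tangents r0 rE.
pose u k := (ck k - c) / (s%:num * (1 + r k))%:C.
have ckE k : ck k = c + s%:num%:C * ((1 + r k)%:C * u k).
  have nz : (s%:num * (1 + r k))%:C != 0 by rewrite real_complex_neq0 // mulr_gt0 ?addr_gt0.
  by rewrite mulrA -(rmorphM (real_complex R)) /u [X in _ + X]mulrC divfK // addrC subrK.
have contact k : sqn (c - ck k) = (s%:num * (1 + r k)) ^+ 2 /\
    z k = Some (c + s%:num%:C * u k).
  have := zC k; rewrite PE CE => /touch_circles []; rewrite skE => -> ->.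
  split; first by ring.
  have nz : 1 + (r k)%:C != 0.
    by rewrite -(rmorph1 (real_complex R)) -rmorphD real_complex_neq0 // addr_gt0.
  have -> : s%:num * r k / (s%:num * r k + s%:num) = r k / (1 + r k).
    by field; rewrite !gt_eqF ?addr_gt0 ?mulr_gt0.
  by congr Some; rewrite ckE rmorphM fmorphV; field; exact: nz.
have zE k : z k = Some (c + s%:num%:C * u k) by have [] := contact k.
have nu k : sqn (u k) = 1.
  have := (contact k).1; rewrite ckE.
  have -> : c - (c + s%:num%:C * ((1 + r k)%:C * u k)) =
    (- (s%:num * (1 + r k)))%:C * u k by ring.
  rewrite sqnM sqnC sqrrN -[RHS]mulr1; apply: mulfI.
  by rewrite expf_neq0 // gt_eqF // mulr_gt0 ?addr_gt0.
have wcontact k :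
    sqn ((1 + r (k + 1))%:C * u (k + 1) - (1 + r k)%:C * u k) = (r k + r (k + 1)) ^+ 2 /\
    w k = Some (c + s%:num%:C * outer_contact r u k).
  have := wP k; rewrite !PE => /touch_circles []; rewrite !skE.
  have nz : (r k)%:C + (r (k + 1))%:C != 0 by rewrite -rmorphD real_complex_neq0 // addr_gt0.
  have -> : s%:num * r k / (s%:num * r k + s%:num * r (k + 1)) = r k / (r k + r (k + 1)).
    by field; rewrite !gt_eqF ?addr_gt0 ?mulr_gt0.
  have -> : ck (k + 1) - ck k =
    s%:num%:C * ((1 + r (k + 1))%:C * u (k + 1) - (1 + r k)%:C * u k).
    by rewrite !ckE; ring.
  rewrite sqnM sqnC => dist ->; split.
    by apply: (mulfI (expf_neq0 2 sn)); rewrite dist; ring.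
  by congr Some; rewrite ckE /outer_contact; field; exact: nz.
have wE k : w k = Some (c + s%:num%:C * outer_contact r u k) by have [] := wcontact k.
have area : forall k l, l != k -> l != k + 1 -> 0 < signed_area (u k) (u (k + 1)) (u l).
  apply: consecutive_area => i j k ij jk; have := zO i j k ij jk.
  by rewrite CE !zE /= signed_area_affine pmulr_rgt0 // exprn_gt0.
have dist k := (wcontact k).1.
have q0 k : 0 < s%:num * Num.sqrt (r k) by rewrite mulr_gt0 ?sqrtr_gt0.
have [e [p ep]] := concentric_contacts r0 t0 rE tE tr nu dist area.
pose S k := OCircle (c + s%:num%:C * e k) (PosNum (q0 k)) true.
have inS k v : sqn (v - e k) = r k -> points (S k) (Some (c + s%:num%:C * v)).
  by move=> vk; apply/(homothetic_circle _ _ _ s0 (d := r k)) => //; apply: ltW.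
have Szprev k : points (S k) (z (k - 1)) by rewrite zE; apply: inS; have [_ []] := ep k.
have Sznext k : points (S k) (z (k + 1)) by rewrite zE; apply: inS; have [_ []] := ep k.
have Swnext k : points (S k) (w k) by rewrite wE; apply: inS; have [_ []] := ep k.
have Swprev k : points (S k) (w (k - 1)) by rewrite wE; apply: inS; have [_ []] := ep k.
pose p' := c + s%:num%:C * p.
have Sp k : points (S k) (Some p') by apply: inS; have [_ []] := ep k.
have sC : s%:num%:C != 0 by rewrite real_complex_neq0.
have zp k : z k <> Some p'.
  by rewrite zE => -[] /addrI /(mulfI sC) uk; have [] := ep k; rewrite uk.
(* Otherwise [w k] would be the contact of both [P k] and [P (k + 1)] with [C], against the
   injectivity of [z]. *)
have wC k : ~ points C (w k).
  move=> Cw; have wz m : points (P m) (w k) -> w k = z m.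
    move=> Pw; have [ptE _] := zC m.
    by have : (points (P m) `&` points C)%classic (w k) by []; rewrite ptE.
  have [wPP _] := wP k; have : [set w k]%classic (w k) by [].
  rewrite -wPP => -[/wz wk /wz]; rewrite wk => /zI /eqP.
  by rewrite -subr_eq0 opprD addrA subrr sub0r.
have zCz k : points C (z k).
  by have [ptE _] := zC k; have : [set z k]%classic (z k) by []; rewrite -ptE => -[].
pose zc k := c + s%:num%:C * u k.
pose wc k := c + s%:num%:C * outer_contact r u k.
have zcE k : z k = Some (zc k) by exact: zE.
have wcE k : w k = Some (wc k) by exact: wE.
have zcI k m : k <> m -> zc k <> zc m by move=> km E; apply/km/zI; rewrite !zcE E.
have zwc k m : zc k <> wc m by move=> E; apply: (wC m); rewrite wcE -E -zcE.
have ne2 (k : 'Z_6) : k - 1 <> k + 1.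
  by move/eqP; rewrite -subr_eq0; have -> : k - 1 - (k + 1) = - 2 by ring.
have through3 k D x y v : x <> y -> x <> v -> y <> v ->
    points (S k) (Some x) -> points (S k) (Some y) -> points (S k) (Some v) ->
    points D (Some x) -> points D (Some y) -> points D (Some v) ->
    points D = points (S k).
  move=> xy xv yv Sx Sy Sv Dx Dy Dv; apply: (circle_through3 xy xv yv) => q.
    by rewrite !inE => /or3P[] /eqP ->.
  by rewrite !inE => /or3P[] /eqP ->.
exists (fun k => points (S k)); split=> [k|].
  split.
    by split; [exists (S k) | split].
  move=> A [[D ->]] [Dzp Dzn Dw _]; apply/esym.
  apply: (through3 k D (zc (k - 1)) (zc (k + 1)) (wc k)); rewrite -?zcE -?wcE //.
  exact: zcI.
exists (Some p'); split=> // q Sq.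
have Sq0 := Sq 0; case: q Sq Sq0 => [q|] // Sq _; congr Some.
have [//|/eqP pq] := eqVneq p' q.
(* A second common point [q] must be the other point shared by [S k] and [S (k + 2)], for every [k];
   taking [k = 0] and [k = 1] then identifies two distinct contacts. *)
have qz k : q = zc (k + 1).
  have [//|/eqP qzk] := eqVneq q (zc (k + 1)); exfalso; apply: (wC k).
  have k3 : k + 2 - 1 = k + 1 by ring.
  have SS : points (S (k + 2)) = points (S k).
    have Szk : points (S (k + 2)) (z (k + 1)) by rewrite -k3.
    apply: (through3 k _ (zc (k + 1)) p' q); rewrite -?zcE //.
      by move=> E; apply: (zp (k + 1)); rewrite zcE E.
    by move=> E; apply: qzk.
  suff -> : points C = points (S k) by [].
  have Szk : points (S k) (z (k + 2 + 1)) by rewrite -SS.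
  apply: (through3 k C (zc (k - 1)) (zc (k + 1)) (zc (k + 2 + 1))); rewrite -?zcE //;
    apply: zcI.
  - exact: ne2.
  - by move/eqP; rewrite -subr_eq0; have -> : k - 1 - (k + 2 + 1) = - 4 by ring.
  - by move/eqP; rewrite -subr_eq0; have -> : k + 1 - (k + 2 + 1) = - 2 by ring.
by case: (@zcI (0 + 1) (1 + 1)) => //; rewrite -!qz.
Qed.

(** * The hexagonal lattice and the conclusion *)

Lemma omega_sqr (R : realType) : omega R ^+ 2 = omega R - 1.
Proof.
pose x : R := pi / 3; have -> : omega R = cos x +i* sin x by [].
have pi0 := pi_gt0 R.
have cx0 : 0 < cos x by apply: cos_gt0_pihalf; rewrite /x; apply/andP; split; lra.
(* Twice [pi / 3] is [pi - pi / 3]; the double-angle formula then gives a quadratic equation for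
   [cos x] with a single positive root. *)
have cE : cos (x *+ 2) = - cos x.
  have -> : x *+ 2 = - x + pi by rewrite /x; field.
  by rewrite cosDpi cosN.
have c2 : cos x = 1 / 2.
  move: cE; rewrite cos_mulr2n => h.
  have /eqP : (cos x + 1) * (2 * cos x - 1) = 0 by lra.
  by rewrite mulf_eq0 => /orP[] /eqP; lra.
have := cos2Dsin2 x; rewrite c2 => s2.
move: (sin x) s2 => y s2; apply/eqP; rewrite expr2 eq_complex /=.
by apply/andP; split; apply/eqP; lra.
Qed.

(** Powers of [omega] stay in the lattice because [omega ^+ 2 = omega - 1]. *)
Lemma HL_petal (R : realType) (v : R[i]) n : HL v -> HL (v + omega R ^+ n).
Proof.
have HLD x y : HL x -> HL y -> HL (x + y) :> Prop.
  move=> [a [b ->]] [d [e ->]]; exists (a + d), (b + e); rewrite !intrD; ring.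
have HLX m : HL (omega R ^+ m).
  elim: m => [|m [a [b IH]]]; first by exists 1, 0; rewrite expr0; ring.
  exists (- b), (a + b); rewrite exprS IH !intrD intrN.
  transitivity (a%:~R * omega R + b%:~R * omega R ^+ 2); first by ring.
  by rewrite omega_sqr; ring.
by move=> vHL; apply: HLD.
Qed.

Theorem proposition4p1 (R : realType) (C : R[i]%C -> ocircle R)
  (hC : Doyle_spiral C) : conformally_symmetric C.
Proof.
have [packing [c [r [CE doyle]]]] := hC; split=> // v vHL z w.
apply: (doyle_flower (CE v vHL) (fun k => CE _ (HL_petal k vHL))) => k.
  by have [] := doyle v vHL k.
by have [] := doyle v vHL k.
Qed.
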